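(* Let $k\ge 2$ be a fixed integer and assume the Unbalanced Supersaturation Conjecture for this $k$: there is a constant $c_k>0$ such that every bipartite graph with bipartition $A\sqcup B$, $m$ edges and $t$ cycles of length $2k$, with $m\ge 100k(|A|+|B|+(|A||B|)^{(k+1)/(2k)})$, satisfies $t\ge c_k\, m^{2k}/(|A|^k|B|^k)$. Then for every graph $G$ with $t$ cycles of length $2k$ and any vertex subsets $A,B\subseteq V(G)$, not necessarily disjoint, \[ e(A,B)\le O\!\left(|A|+|B|+(|A||B|)^{(k+1)/(2k)}+t^{1/(2k)}\sqrt{|A||B|}\right). \]
   Context: $e(A,B)$ denotes the number of edges of $G$ with one endpoint in $A$ and the other in $B$. The implied constant depends only on $k$. *)

(* Defs.v *)
From mathcomp Require Import all_boot all_order all_algebra.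
From mathcomp Require Import reals exp.

Set Implicit Arguments.
Unset Strict Implicit.
Unset Printing Implicit Defensive.

Import Order.TTheory GRing.Theory Num.Theory.

Record sgraph (V : finType) := SGraph {
  adj :> rel V;
  adj_sym : symmetric adj;
  adj_irrefl : irreflexive adj
}.

Section Graphs.
Variables (V : finType) (G : sgraph V).

Definition edges : {set {set V}} :=
  [set E : {set V} | [exists x, exists y, G x y && (E == [set x; y])]].

(* A and B may overlap; an edge inside A :&: B is counted once. *)
Definition edges_between (A B : {set V}) : {set {set V}} :=
  [set E in edges | [exists x in A, exists y in B, E == [set x; y]]].

(* A cycle is a subgraph, not a closed walk: it is represented by its edge
   set, so rotations and reflections of a vertex sequence give one cycle. This
   is only meaningful for n >= 3. *)
Definition cycles_of_length (n : nat) : {set {set {set V}}} :=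
  [set C : {set {set V}} | [exists c : n.-tuple V,
     ucycleb G c && (C == [set [set x; next c x] | x in c])]].

Definition bipartition (A B : {set V}) : Prop :=
  [/\ A :|: B = [set: V],
      [disjoint A & B]
    & forall x y, G x y ->
        (x \in A) && (y \in B) || (x \in B) && (y \in A)].

End Graphs.

Local Open Scope ring_scope.

(* If A or B is empty then there are no edges, and the quotient in the
   conclusion is 0 / 0 = 0. *)
Definition unbalanced_supersaturation (R : realType) (k : nat) : Prop :=
  exists2 c : R, 0 < c &
    forall (V : finType) (G : sgraph V) (A B : {set V}),
      bipartition G A B ->
      let a : R := #|A|%:R in
      let b : R := #|B|%:R in
      let m : R := #|edges G|%:R in
      let t : R := #|cycles_of_length G (2 * k)|%:R in
      m >= 100 * k%:R * (a + b + (a * b) `^ (k.+1%:R / (2 * k)%:R)) ->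
      t >= c * (m ^+ (2 * k) / (a ^+ k * b ^+ k)).

(* Main.v *)
Require Import Defs.
From mathcomp Require Import all_boot all_order all_algebra.
From mathcomp Require Import reals exp.
Import Order.TTheory GRing.Theory Num.Theory.
Local Open Scope ring_scope.

(** For a uniformly random vertex set [S], an edge joining [A] to [B] joins
    [A :&: S] to [B :\: S] with probability at least 1/4, so some [S] keeps a
    quarter of the edges between two disjoint sets.  The bipartite graph they
    span has no more 2k-cycles than [G]; either its number of edges is below
    the supersaturation threshold, or the conjecture bounds it in terms of
    [t]. *)

(** The sets [S] fall into four classes by the membership of [x] and of [y]. Within one class [S] is
    determined by its other elements, so adding [x] and removing [y] maps each class injectively
    into [D]. *)
Lemma card_separating_sets (T : finType) (x y : T) : x != y ->
  (#|{set T}| <= 4 * #|[set S : {set T} | (x \in S) && (y \notin S)]|)%N.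
Proof.
move=> xy; set D := [set S : {set T} | _].
pose F (b : bool * bool) :=
  [set S : {set T} | ((x \in S) == b.1) && ((y \in S) == b.2)].
have leF b : (#|F b| <= #|D|)%N.
  rewrite -(card_in_imset (f := fun S => (x |: S) :\ y)).
    apply/subset_leq_card/subsetP => _ /imsetP[S _ ->].
    by rewrite !inE !eqxx xy.
  move=> S1 S2; rewrite !inE => /andP[/eqP x1 /eqP y1] /andP[/eqP x2 /eqP y2].
  move=> eqS; apply/setP => z.
  have [->|zx] := eqVneq z x; first by rewrite x1 x2.
  have [->|zy] := eqVneq z y; first by rewrite y1 y2.
  by have /setP/(_ z) := eqS; rewrite !inE (negPf zx) zy.
rewrite -cardsT.
have -> : [set: {set T}] = \bigcup_b F b.
  apply/setP => S; rewrite inE; symmetry; apply/bigcupP.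
  by exists (x \in S, y \in S); rewrite ?inE ?eqxx.
apply: (leq_trans (n := \sum_b #|F b|)).
  elim/big_rec2: _ => [|b n U _ leU]; first by rewrite cards0.
  by rewrite (leq_trans (leq_card_setU _ _)) ?leq_add2l.
apply: (leq_trans (n := \sum_(b : bool * bool) #|D|)).
  by apply: leq_sum => b _; apply: leF.
by rewrite sum_nat_const card_prod card_bool.
Qed.

Lemma edges_between_cut {V : finType} (G : sgraph V) (A B : {set V}) :
  exists S : {set V},
    (#|edges_between G A B| <= 4 * #|edges_between G (A :&: S) (B :\: S)|)%N.
Proof.
pose f (S : {set V}) := #|edges_between G (A :&: S) (B :\: S)|.
exists [arg max_(S > set0) f S]; case: arg_maxnP => // S _ maxS.
have sum_le : (\sum_(S' : {set V}) f S' <= #|{set V}| * f S)%N.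
  by rewrite -sum_nat_const; apply: leq_sum => S' _; apply: maxS.
have V_gt0 : (0 < #|{set V}|)%N by apply/card_gt0P; exists set0.
(* The maximum is at least the average; scaling by the number of sets [S] keeps the averaging in
   natural numbers. *)
rewrite -(leq_pmul2l V_gt0) mulnCA.
apply: (leq_trans _ (leq_mul (leqnn 4) sum_le)).
have -> : (\sum_S' f S' = \sum_(S' : {set V}) \sum_(E : {set V})
    (E \in edges_between G (A :&: S') (B :\: S')))%N.
  by apply: eq_bigr => S' _; rewrite /f -sum1_card big_mkcond.
(* Double counting: it suffices that each edge survives for at least a quarter of the sets. One
   orientation [x], [y] of the edge is enough, so an overlap of [A] and [B] does no harm. *)
rewrite exchange_big /= big_distrr /= mulnC -sum_nat_const big_mkcond /=.
apply: leq_sum => E _; case: ifP => // EAB.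
have := EAB; rewrite inE => /andP[EG /exists_inP[x xA /exists_inP[y yB /eqP EE]]].
have xy : x != y.
  apply/eqP => exy; move: EG; rewrite inE => /existsP[u /existsP[v]].
  case/andP=> uv; rewrite EE -exy setUid => /eqP/setP Euv.
  have := Euv u; have := Euv v; rewrite !inE !eqxx orbT /= => /eqP ev /eqP eu.
  by rewrite eu ev adj_irrefl in uv.
apply: (leq_trans (card_separating_sets _ _ _ xy)); rewrite leq_mul2l /=.
rewrite -sum1_card big_mkcond /=; apply: leq_sum => S' _.
case: ifP => //; rewrite inE => /andP[xS yS].
rewrite lt0b inE EG; apply/exists_inP; exists x; first by rewrite inE xA.
by apply/exists_inP; exists y; rewrite ?EE // inE yB yS.
Qed.

Section BipartiteSubgraph.
Variables (V : finType) (G : sgraph V) (A B : {set V}).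

(** A [bipartition] has to cover the whole vertex type, so the vertices outside both sides are
    removed by passing to a subtype. *)
Definition bip_vertex := {x : V | x \in A :|: B}.

Definition bip_adj : rel bip_vertex := fun x y =>
  G (val x) (val y) && ((val x \in A) && (val y \in B)
                        || (val x \in B) && (val y \in A)).

Lemma bip_adj_sym : symmetric bip_adj.
Proof.
move=> x y; rewrite /bip_adj adj_sym orbC.
by rewrite (andbC (val x \in A)) (andbC (val x \in B)).
Qed.

Lemma bip_adj_irrefl : irreflexive bip_adj.
Proof. by move=> x; rewrite /bip_adj adj_irrefl. Qed.

Definition bip_graph : sgraph bip_vertex := SGraph bip_adj_sym bip_adj_irrefl.

Definition bip_part (D : {set V}) : {set bip_vertex} := [set x | val x \in D].

Lemma card_bip_part (D : {set V}) : (#|bip_part D| <= #|D|)%N.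
Proof.
rewrite -(card_imset (bip_part D) val_inj); apply/subset_leq_card/subsetP.
by move=> _ /imsetP[x xD ->]; rewrite inE in xD.
Qed.

Lemma bip_graph_bipartition :
  [disjoint A & B] -> bipartition bip_graph (bip_part A) (bip_part B).
Proof.
move=> dAB; split.
- by apply/setP => x; rewrite !inE; have := valP x; rewrite inE.
- rewrite disjoint_subset; apply/subsetP => x; rewrite !inE.
  by move=> xA; rewrite (disjointFr dAB xA).
- by move=> x y /andP[_]; rewrite !inE.
Qed.

Lemma card_bip_edges : (#|edges_between G A B| <= #|edges bip_graph|)%N.
Proof.
rewrite -(card_imset _ (imset_inj (@val_inj _ _ bip_vertex))).
apply/subset_leq_card/subsetP => E; rewrite inE.
case/andP=> EG /exists_inP[x xA /exists_inP[y yB /eqP EE]].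
(* Comparing the unordered pairs leaves four cases. When [x] and [y] equal the same endpoint of
   [uv], the other endpoint coincides with it as well, and [uv] still gives the goal. *)
have Gxy : G x y.
  move: EG; rewrite inE => /existsP[u /existsP[v /andP[uv]]].
  rewrite EE => /eqP/setP Euv.
  have := Euv u; have := Euv v; have := Euv x; have := Euv y.
  rewrite !inE !eqxx ?orbT /=.
  case/esym/orP=> /eqP ey; case/esym/orP=> /eqP ex; rewrite ?ex ?ey //.
  - by move=> /orP[] /eqP ev _; move: uv; rewrite ev ?ex ?ey //.
  - by rewrite adj_sym.
  - by move=> _ /orP[] /eqP eu; move: uv; rewrite eu ?ex ?ey.
have xAB : x \in A :|: B by rewrite inE xA.
have yAB : y \in A :|: B by rewrite inE yB orbT.
apply/imsetP; exists [set Sub x xAB; (Sub y yAB : bip_vertex)].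
  rewrite inE; apply/existsP; exists (Sub x xAB); apply/existsP.
  by exists (Sub y yAB); rewrite eqxx andbT /= /bip_adj /= Gxy xA yB.
by rewrite imsetU1 imset_set1.
Qed.

(** A cycle is a set of edges, so [val] acts on it through two nested images, which stay injective.
    Mapping the vertex sequence commutes with [next], and adjacency in [bip_graph] implies adjacency
    in [G]. *)
Lemma card_bip_cycles (n : nat) :
  (#|cycles_of_length bip_graph n| <= #|cycles_of_length G n|)%N.
Proof.
rewrite -(card_imset _ (imset_inj (imset_inj (@val_inj _ _ bip_vertex)))).
apply/subset_leq_card/subsetP => _ /imsetP[C CG ->].
move: CG; rewrite !inE => /existsP[c /andP[/andP[cyc_c uniq_c] /eqP->]].
apply/existsP; exists [tuple of map val c]; apply/andP; split.
  rewrite /ucycleb /= map_inj_uniq ?uniq_c ?andbT; last exact: val_inj.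
  rewrite cycle_map; apply: sub_cycle cyc_c => x y /=.
  by rewrite /bip_adj => /andP[].
apply/eqP/setP => E; apply/imsetP/imsetP.
- case=> _ /imsetP[x xc ->] ->; exists (val x); first exact: map_f.
  by rewrite imsetU1 imset_set1 next_map //; exact: val_inj.
- case=> _ /mapP[x xc ->] ->.
  exists [set x; next c x]; first by apply/imsetP; exists x.
  by rewrite imsetU1 imset_set1 next_map //; exact: val_inj.
Qed.

End BipartiteSubgraph.

Lemma supersaturation_upper_bound (R : realType) (k : nat) (c m a b t : R) :
  (0 < k)%N -> 0 < c -> 0 <= m -> 0 < a -> 0 < b -> 0 <= t ->
  c * (m ^+ (2 * k) / (a ^+ k * b ^+ k)) <= t ->
  m <= c^-1 `^ (1 / (2 * k)%:R) * (t `^ (1 / (2 * k)%:R) * Num.sqrt (a * b)).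
Proof.
move=> k_gt0 c_gt0 m_ge0 a_gt0 b_gt0 t_ge0 le_t.
have n_gt0 : (0 < 2 * k)%N by rewrite muln_gt0.
have rootK (x : R) : 0 <= x -> (x `^ (1 / (2 * k)%:R)) ^+ (2 * k) = x.
  move=> x_ge0; rewrite -powR_mulrn ?powR_ge0 // -powRrM.
  by rewrite div1r mulVf ?powRr1 // pnatr_eq0 -lt0n.
(* Both sides are nonnegative, so their powers of exponent [2 * k] are compared; the square root
   then becomes [a ^+ k * b ^+ k]. *)
rewrite -(ler_pXn2r n_gt0) ?nnegrE // ?mulr_ge0 ?powR_ge0 ?sqrtr_ge0 //.
rewrite !exprMn !rootK ?invr_ge0 ?(ltW c_gt0) //.
rewrite (exprM (Num.sqrt _)) sqr_sqrtr ?(ltW (mulr_gt0 _ _)) // exprMn.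
have ab_gt0 : 0 < a ^+ k * b ^+ k by rewrite mulr_gt0 ?exprn_gt0.
by rewrite [leRHS]mulrA -ler_pdivrMr // ler_pdivlMl.
Qed.

Theorem corollaryA1 (R : realType) (k : nat) (hk : (2 <= k)%N)
    (hconj : unbalanced_supersaturation R k) :
  exists2 C : R, 0 < C &
    forall (V : finType) (G : sgraph V) (A B : {set V}),
      let a : R := #|A|%:R in
      let b : R := #|B|%:R in
      let t : R := #|cycles_of_length G (2 * k)|%:R in
      #|edges_between G A B|%:R <=
        C * (a + b + (a * b) `^ (k.+1%:R / (2 * k)%:R)
             + t `^ (1 / (2 * k)%:R) * Num.sqrt (a * b)).
Proof.
case: hconj => c c_gt0 hc.
have k_gt0 : (0 < k)%N by apply: leq_trans hk.
pose K : R := 100 * k%:R; pose L := c^-1 `^ (1 / (2 * k)%:R).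
have K_gt0 : 0 < K by rewrite mulr_gt0 ?ltr0n.
have K_ge0 := ltW K_gt0.
have L_ge0 : 0 <= L by rewrite powR_ge0.
have KL_gt0 : 0 < K + L by rewrite ltr_pwDl.
(* The cut costs the factor 4, [K] is the factor in the supersaturation threshold, and [L] comes
   from solving the conjectured inequality for the number of edges. *)
exists (4 * (K + L)); first by rewrite mulr_gt0.
move=> V G A B /=; set a : R := #|A|%:R; set b : R := #|B|%:R.
set t : R := #|cycles_of_length G _|%:R.
have [S leS] := edges_between_cut G A B.
set A1 := A :&: S in leS; set B1 := B :\: S in leS.
have dAB : [disjoint A1 & B1].
  rewrite disjoint_subset; apply/subsetP => x; rewrite !inE.
  by case/andP=> _ ->.
have partP := bip_graph_bipartition _ G _ _ dAB; have := @hc _ _ _ _ partP.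
have leA : (#|bip_part _ A1 B1 A1| <= #|A|)%N.
  exact: leq_trans (card_bip_part _ _ _ _) (subset_leq_card (subsetIl _ _)).
have leB : (#|bip_part _ A1 B1 B1| <= #|B|)%N.
  exact: leq_trans (card_bip_part _ _ _ _) (subset_leq_card (subsetDl _ _)).
have leT := card_bip_cycles _ G A1 B1 (2 * k).
have := card_bip_edges _ G A1 B1.
set H := bip_graph _ _ _ _ in leT partP *.
set A2 := bip_part _ _ _ A1 in leA partP *.
set B2 := bip_part _ _ _ B1 in leB partP *.
move=> leE /=; rewrite -/K => superH.
apply: (le_trans (y := 4 * #|edges H|%:R)).
  by rewrite -natrM ler_nat (leq_trans leS) // leq_mul2l leE.
rewrite -mulrA ler_pM2l ?ltr0n //.
set p := k.+1%:R / _ in superH *; set q := 1 / _ in L L_ge0 KL_gt0 *.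
have p_ge0 : 0 <= p by rewrite divr_ge0 ?ler0n.
have q_ge0 : 0 <= q by rewrite divr_ge0 ?ler0n.
have leab : #|A2|%:R * #|B2|%:R <= a * b.
  by rewrite ler_pM ?ler0n ?ler_nat.
have ab0 : 0 <= #|A2|%:R * #|B2|%:R :> R by rewrite mulr_ge0 ?ler0n.
set X := a + b + _; set Y := _ * Num.sqrt _.
have X_ge0 : 0 <= X by rewrite !addr_ge0 ?ler0n ?powR_ge0.
have Y_ge0 : 0 <= Y by rewrite mulr_ge0 ?powR_ge0 ?sqrtr_ge0.
have KX_ge0 := mulr_ge0 K_ge0 X_ge0; have KY_ge0 := mulr_ge0 K_ge0 Y_ge0.
have LX_ge0 := mulr_ge0 L_ge0 X_ge0; have LY_ge0 := mulr_ge0 L_ge0 Y_ge0.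
(* Of the four nonnegative products, [K * X] serves below the threshold and [L * Y] above it. *)
rewrite mulrDl (mulrDr K) (mulrDr L).
have le_sum : #|A2|%:R + #|B2|%:R + (#|A2|%:R * #|B2|%:R) `^ p <= X.
  rewrite !lerD ?ler_nat //.
  by apply: ge0_ler_powR; rewrite ?nnegrE ?(le_trans ab0 leab).
have [small|large] := leP #|edges H|%:R
    (K * (#|A2|%:R + #|B2|%:R + (#|A2|%:R * #|B2|%:R) `^ p)).
  apply: (le_trans small); apply: (le_trans (y := K * X)).
    by rewrite ler_pM2l.
  by rewrite -addrA lerDl (addr_ge0 KY_ge0 (addr_ge0 LX_ge0 LY_ge0)).
have {}superH := superH (ltW large).
apply: (le_trans (y := L * Y)); last first.
  by rewrite addrA lerDr (addr_ge0 (addr_ge0 KX_ge0 KY_ge0) LX_ge0).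
(* An edge of [H] makes both parts nonempty, so that the quotient in the conjecture has a positive
   denominator. *)
have [E0|[E]] := set_0Vmem (edges H).
  by rewrite E0 cards0 mulr_ge0.
rewrite inE => /existsP[u /existsP[v /andP[uv _]]].
have [A2_gt0 B2_gt0] : (0 < #|A2|)%N /\ (0 < #|B2|)%N.
  case: partP => _ _ /(_ _ _ uv) /orP[] /andP[hu hv].
    by split; apply/card_gt0P; [exists u | exists v].
  by split; apply/card_gt0P; [exists v | exists u].
apply: (le_trans (supersaturation_upper_bound _ _ _ _ _ _ _ _ _ _ _ _ _ superH));
  rewrite ?ler0n ?ltr0n //.
(* The bound increases with the cycle count and the part sizes, so it passes from [H] to [G], [A]
   and [B]. *)
rewrite ler_wpM2l // ler_pM ?powR_ge0 ?sqrtr_ge0 //.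
  by apply: ge0_ler_powR; rewrite ?nnegrE ?ler0n ?ler_nat.
by rewrite ler_sqrt ?(le_trans ab0 leab).
Qed.
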